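(* Let $l_0\ge 0$ be an integer, let $l$ be the line $x=y+l_0$ in the plane, and let $\varphi_l:\mathbb{Z}^2\to\mathbb{Z}^2$ be the reflection $\varphi_l(x,y)=(l_0+y,\,x-l_0)$. Let $A_0,B_0\subset\mathbb{Z}^2\cap\{(x,y): x\le y+l_0\}$ be two disjoint finite sets, and let $\{X_n\}_{n\ge 0}$ be a simple random walk on $\mathbb{Z}^2$ starting at $0$. Then for any integer $L\ge 0$, $$P\left(A_0\cup B_0\subseteq \mathrm{Trace}\big(\{X_n\}_{n=0}^L\big)\right)\ \ge\ P\left(A_0\cup \varphi_l(B_0)\subseteq \mathrm{Trace}\big(\{X_n\}_{n=0}^L\big)\right).$$
   Context: For a sequence $x_0,\dots,x_L$ of points, $\mathrm{Trace}(x_0,\dots,x_L)=\{x: \exists\, 0\le i\le L,\ x_i=x\}$ is the set of points visited. Simple random walk on $\mathbb{Z}^2$ moves at each step to one of the $4$ nearest neighbors with probability $1/4$ each, independently. *)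

(* Defs.v *)
From mathcomp Require Import all_boot all_order all_algebra finmap.
From mathcomp Require Import all_classical all_reals all_analysis.

Set Implicit Arguments.
Unset Strict Implicit.
Unset Printing Implicit Defensive.

Import Order.TTheory GRing.Theory Num.Theory.
Local Open Scope classical_set_scope.
Local Open Scope ring_scope.

Notation Z2 := (int * int)%type.

Definition unit_steps : seq Z2 :=
  [:: (1, 0); (-1, 0); (0, 1); (0, -1)].

Definition Trace (S : Type) (x : nat -> S) (L : nat) : set S :=
  [set z | exists i : nat, (i <= L)%N /\ x i = z].

Definition half_plane (l0 : int) : set Z2 := [set p | p.1 <= p.2 + l0].

Definition reflection (l0 : int) (p : Z2) : Z2 := (l0 + p.2, p.1 - l0).

(* Measurability with respect to the discrete sigma-algebra on the codomain. *)
Definition discrete_rv (d : measure_display) (T : measurableType d) (S : Type)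
    (Y : T -> S) : Prop :=
  forall U : set S, measurable (Y @^-1` U).

(* Mutual independence of discrete random variables: every subset of the
   codomain is measurable, so U ranges over arbitrary families of sets. *)
Definition mutually_independent (d : measure_display) (T : measurableType d)
    (R : realType) (P : probability T R) (S : Type) (Y : nat -> T -> S) : Prop :=
  forall (J : {fset nat}) (U : nat -> set S),
    P (\bigcap_(j in [set` J]) (Y j @^-1` U j)) =
    (\prod_(j <- J) P (Y j @^-1` U j))%E.

Definition increment (T : Type) (X : nat -> T -> Z2) (n : nat) (w : T) :
    Z2 :=
  X n.+1 w - X n w.

(* The four probabilities 1/4 add up to 1, so steps_uniform fixes the whole law
   of each increment. *)
Record simple_random_walk (d : measure_display) (T : measurableType d)
    (R : realType) (P : probability T R) (X : nat -> T -> Z2) : Prop := {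
  walk_measurable : forall n, discrete_rv (X n);
  walk_start : forall w, X 0%N w = (0, 0);
  steps_uniform : forall n e, e \in unit_steps ->
    P (increment X n @^-1` [set e]) = (4^-1)%:E;
  steps_independent : mutually_independent P (increment X)
}.

(* Main.v *)
Require Import Defs.
From mathcomp Require Import all_boot all_order all_algebra finmap.
From mathcomp Require Import all_classical all_reals all_analysis.
From mathcomp Require Import zify lra.
Import Order.TTheory GRing.Theory Num.Theory.
Local Open Scope classical_set_scope.
Local Open Scope ring_scope.

(** Both events depend on finitely many steps, each of the [4 ^ n] step
sequences being equally likely, so the inequality compares two numbers of
walks.  Let [H] be the half plane, [r] the reflection and [V n x C] the number
of walks from [x] that have visited every point of [C] within their first [n]
positions.  The theorem is the case [x = 0] of

  (S)  V n x (A u r B) <= V n x (A u B)      for x in H and A, B inside H.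

While the walk is strictly inside [H] it can only visit points of [A] on the
left and points of [A u B] on the right, so (S) passes from the neighbours of
[x] to [x].  The case of interest is [x] on the line.  There the steps come in
pairs exchanged by [r], and one has to follow simultaneously the walk entering
[H] and its mirror image.  During such an excursion the first walk deletes
points from [A] and [B] when the target is [A u B], but only from [A] when it
is [A u r B]; the mirror walk deletes points only from [r B], and only in the
second case.  This leads to a statement with two pairs of sets, [A'] inside
[A] and [B'] inside [B] being the points that the excursion has missed:

  (T)  V n x (A' u r B) + V n (r x) (A u r B')
         <= V n x (A' u B') + V n (r x) (A u B).

Excursions preserve (T) step by step.  When they return to the line, [r x = x]
and (S) bounds the left side by [V n x (A' u B) + V n x (A u B')], so what is
missing is the inequality

  V n x (A' u B) + V n x (A u B') <= V n x (A' u B') + V n x (A u B).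

It holds because [V n x] is supermodular: the walks covering both [A' u B] and
[A u B'] are those covering the union [A u B], and a walk covering one of the
two covers their intersection, which contains [A' u B'].  Thus (S) and (T) are
proved together by induction on [n] in [covering_count_reflection], and
[probability_trace] expresses the probabilities by these numbers. *)

(** * Counting walks that cover a set *)

(** The current position is deleted from the target before each step, so the
[n] positions at times [0, ..., n - 1] count and the last of the [n] steps is
immaterial.  It leaves the empty walk no position at all, which makes the base
case of every induction trivial. *)
Fixpoint covering_count (n : nat) (x : Z2) (C : set Z2) : nat :=
  if n is m.+1 then
    (\sum_(e <- unit_steps) covering_count m (x + e)%R (C `\ x))%N
  else `[< C = set0 >].

Lemma covering_count_subset n x (C D : set Z2) :
  C `<=` D -> (covering_count n x D <= covering_count n x C)%N.
Proof.
elim: n x C D => [|n IH] x C D CD /=.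
  case: asboolP => // D0; case: asboolP => // -[].
  by apply/seteqP; split => // z /CD; rewrite D0.
by apply: leq_sum => e _; apply: IH => z [Cz zx]; split => //; exact: CD.
Qed.

(** Inclusion-exclusion: the walks covering [C] and those covering [D] meet in
the walks covering the union, and all of them cover the intersection. *)
Lemma covering_count_supermodular n x (C D : set Z2) :
  (covering_count n x C + covering_count n x D <=
   covering_count n x (C `|` D) + covering_count n x (C `&` D))%N.
Proof.
elim: n x C D => [|n IH] x C D /=.
  case: asboolP => [->|_]; rewrite ?set0U ?set0I.
    by rewrite addnC leq_add2l; case: asboolP => // _; rewrite asboolT.
  case: asboolP => [->|_] //; rewrite setI0 (asboolT (erefl _)).
  by rewrite leq_addl.
rewrite -!big_split leq_sum // => e _ /=.
have -> : (C `|` D) `\ x = (C `\ x) `|` (D `\ x) by rewrite setDUl.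
have -> : (C `&` D) `\ x = (C `\ x) `&` (D `\ x).
  by apply/seteqP; split=> z /=; tauto.
exact: IH.
Qed.

(** How the sum in (T) behaves once the excursion is back on the line. *)
Lemma covering_count_exchange n x (A A' B B' : set Z2) :
  A' `<=` A -> B' `<=` B ->
  (covering_count n x (A' `|` B) + covering_count n x (A `|` B') <=
   covering_count n x (A' `|` B') + covering_count n x (A `|` B))%N.
Proof.
move=> A'A B'B; apply: leq_trans (covering_count_supermodular _ _ _ _) _.
rewrite addnC leq_add // covering_count_subset //.
  by move=> z /=; have := A'A z; have := B'B z; tauto.
by move=> z /=; tauto.
Qed.

(** * Reflection in the line *)

Lemma reflectionK l0 : involutive (reflection l0).
Proof. by case=> a b; rewrite /reflection /=; congr pair; lia. Qed.

Lemma reflection_line l0 (x : Z2) : x.1 = x.2 + l0 -> reflection l0 x = x.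
Proof. by case: x => a b /= ->; rewrite /reflection /=; congr pair; lia. Qed.

Lemma reflection_image l0 (B : set Z2) z :
  (reflection l0 @` B) z <-> B (reflection l0 z).
Proof.
split=> [[y By <-]|Bz]; first by rewrite reflectionK.
by exists (reflection l0 z) => //; exact: reflectionK.
Qed.

Lemma reflection_notin l0 (B : set Z2) (x : Z2) : B `<=` half_plane l0 ->
  x.1 < x.2 + l0 -> ~ (reflection l0 @` B) x.
Proof.
move=> BH xl /reflection_image/BH; rewrite /half_plane /reflection /=; lia.
Qed.

Lemma sum_unit_steps (f : Z2 -> nat) :
  (\sum_(e <- unit_steps) f e =
   f (1, 0)%R + f (-1, 0)%R + f (0, 1)%R + f (0, -1)%R)%N.
Proof. by rewrite /unit_steps !big_cons big_nil addn0 !addnA. Qed.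

Lemma reflectionD l0 (x e : Z2) :
  reflection l0 (x + e) = reflection l0 x + (e.2, e.1).
Proof.
case: x e => [a b] [c d]; rewrite /reflection; congr pair => /=; lia.
Qed.

(** The reflection permutes the four steps. *)
Lemma sum_reflected_steps l0 (x : Z2) (f : Z2 -> nat) :
  (\sum_(e <- unit_steps) f (reflection l0 x + e)%R =
   \sum_(e <- unit_steps) f (reflection l0 (x + e)%R))%N.
Proof. rewrite !sum_unit_steps !reflectionD /=; lia. Qed.

(** A step changes the difference of the coordinates by one, so it cannot jump
over the line. *)
Lemma half_plane_step l0 (x e : Z2) :
  x.1 < x.2 + l0 -> e \in unit_steps -> half_plane l0 (x + e).
Proof.
rewrite /half_plane !inE => xl /or4P[] /eqP ->; case: x xl => a b /=; lia.
Qed.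

Lemma reflection_setD1 l0 (B : set Z2) x :
  (reflection l0 @` B) `\ reflection l0 x = reflection l0 @` (B `\ x).
Proof.
apply/seteqP; split=> [_ [[y By <-] ne]|_ [y [By ne] <-]].
  by exists y => //; split=> // yx; apply: ne; rewrite yx.
by split; [exists y | move=> /(can_inj (reflectionK l0))].
Qed.

(** * Reflecting part of the target makes it harder to cover *)

(** The induction on (S) and (T) sketched above.  In (T) the first walk is at
[x], its mirror image at [reflection l0 x]; [A'] and [B'] are what the common
excursion has missed, [A] and [B] the targets at the beginning of it. *)
Lemma covering_count_reflection l0 n :
  (forall (x : Z2) (A B : set Z2), half_plane l0 x ->
     A `<=` half_plane l0 -> B `<=` half_plane l0 ->
     covering_count n x (A `|` reflection l0 @` B) <=
     covering_count n x (A `|` B))%N /\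
  (forall (x : Z2) (A A' B B' : set Z2), half_plane l0 x ->
     A `<=` half_plane l0 -> B `<=` half_plane l0 -> A' `<=` A -> B' `<=` B ->
     covering_count n x (A' `|` reflection l0 @` B) +
     covering_count n (reflection l0 x) (A `|` reflection l0 @` B') <=
     covering_count n x (A' `|` B') +
     covering_count n (reflection l0 x) (A `|` B))%N.
Proof.
elim: n => [|n [IHS IHT]].
  have E (A B : set Z2) : A `|` reflection l0 @` B = set0 <-> A `|` B = set0.
    rewrite !setU_eq0; split=> -[-> B0]; split=> //.
      exact: image_set0_set0 B0.
    by rewrite B0 image_set0.
  have E0 x y (A B : set Z2) :
      covering_count 0 x (A `|` reflection l0 @` B) =
      covering_count 0 y (A `|` B).
    by congr nat_of_bool; apply/asbool_equiv_eq.
  split=> [x A B *|x A A' B B' _ _ _ A'A B'B]; rewrite !(E0 _ x) //.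
  exact: covering_count_exchange.
have stepS (x : Z2) (A B : set Z2) : half_plane l0 x ->
     A `<=` half_plane l0 -> B `<=` half_plane l0 ->
     (covering_count n.+1 x (A `|` reflection l0 @` B) <=
     covering_count n.+1 x (A `|` B))%N.
  move=> xH AH BH /=.
  have AxH : A `\ x `<=` half_plane l0 by move=> z [/AH].
  have BxH : B `\ x `<=` half_plane l0 by move=> z [/BH].
  have [xl|] := eqVneq x.1 (x.2 + l0).
    have rx := reflection_line _ _ xl.
    rewrite !setDUl -{1 2 3 4}rx reflection_setD1 rx.
    rewrite !sum_unit_steps.
    (* [x + (-1, 0)] and [x + (0, 1)] are in the half plane, the other two
       neighbours are their mirror images: (T) starts with full sets. *)
    have T1 : half_plane l0 (x + (-1, 0)).
      by rewrite /half_plane /= xl; lia.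
    have T2 : half_plane l0 (x + (0, 1)).
      by rewrite /half_plane /= xl; lia.
    have := IHT _ _ _ _ _ T1 AxH BxH (@subset_refl _ _) (@subset_refl _ _).
    have := IHT _ _ _ _ _ T2 AxH BxH (@subset_refl _ _) (@subset_refl _ _).
    rewrite !reflectionD rx /=; lia.
  move=> xne.
  have xl : x.1 < x.2 + l0 by rewrite lt_neqAle xne.
  (* The points of the reflected set are across the line, so the visit to [x]
     can only delete points of [A] on the left. *)
  rewrite !setDUl [X in _ `|` X](_ : _ = reflection l0 @` B); last first.
    by apply: not_setD1; exact: reflection_notin.
  rewrite !big_seq leq_sum // => e eu.
  apply: leq_trans (IHS _ _ _ (half_plane_step _ _ _ xl eu) AxH BH) _.
  by apply: covering_count_subset => z [|[]]; [left|right].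
split=> // x A A' B B' xH AH BH A'A B'B.
(* Back on the line: apply (S) to both terms, then exchange. *)
have [xl|xne] := eqVneq x.1 (x.2 + l0).
  rewrite reflection_line //.
  apply: leq_trans (covering_count_exchange _ _ _ _ _ _ A'A B'B).
  by apply: leq_add; apply: stepS => // z; [move/A'A/AH|move/B'B/BH].
have xl : x.1 < x.2 + l0 by rewrite lt_neqAle xne.
(* During the excursion [reflection l0 x] is across the line, hence outside [A]
   and [B]; likewise [x] is outside [reflection l0 @` B]. *)
have rxH (D : set Z2) : D `<=` half_plane l0 -> D `\ reflection l0 x = D.
  move=> DH; apply: not_setD1 => Dx; apply: (reflection_notin _ _ _ DH xl).
  exact/reflection_image.
rewrite /= !(sum_reflected_steps _ _ (fun y => covering_count n y _)).
rewrite !setDUl reflection_setD1.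
rewrite (rxH A) // (rxH B) // (not_setD1 (reflection_notin _ _ _ BH xl)).
rewrite -!big_split /= !big_seq leq_sum // => e eu.
by apply: IHT => //; [exact: half_plane_step|move=> z [/A'A]|move=> z [/B'B]].
Qed.

(** * The law of the walk *)

Lemma increment_discrete_rv {d : measure_display} {T : measurableType d}
    (X : nat -> T -> Z2) n :
  (forall k, discrete_rv (X k)) -> discrete_rv (increment X n).
Proof.
move=> mX U.
rewrite [_ @^-1` _](_ : _ = \bigcup_(a : Z2)
    ((X n @^-1` [set a]) `&` (X n.+1 @^-1` [set b | U (b - a)]))).
  apply: countable_bigcupT_measurable; first exact: countableP.
  by move=> a; apply: measurableI; exact: mX.
by apply/seteqP; split=> [w Uw|w [a _ [/= <-]]] //; exists (X n w).
Qed.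

Definition covers_from {T : Type} (X : nat -> T -> Z2) (k n : nat)
    (C : set Z2) : set T :=
  [set w | forall z, C z -> exists2 j, (k <= j < k + n)%N & X j w = z].

Lemma measurable_covers_from {d : measure_display} {T : measurableType d}
    (X : nat -> T -> Z2) k n (C : set Z2) :
  (forall k, discrete_rv (X k)) -> finite_set C ->
  measurable (covers_from X k n C).
Proof.
move=> mX fC.
rewrite [covers_from _ _ _ _](_ : _ = \bigcap_(z in C)
    \bigcup_(j in [set j | (k <= j < k + n)%N]) (X j @^-1` [set z])).
  apply: fin_bigcap_measurable => // z _.
  by apply: bigcup_measurable => j _; exact: mX.
by apply/seteqP; split=> w cw z Cz; have [j kj e] := cw z Cz; exists j.
Qed.

Lemma covers_fromS {T : Type} (X : nat -> T -> Z2) k n C w :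
  covers_from X k n.+1 C w <-> covers_from X k.+1 n (C `\ X k w) w.
Proof.
split=> [cw z [Cz zX]|cw z Cz].
  have [j kj e] := cw z Cz; exists j => //.
  have : j != k by apply/eqP => jk; apply: zX; rewrite -e jk.
  lia.
have [zX|zX] := pselect (z = X k w); first by exists k => //; lia.
by have [j kj e] := cw z (conj Cz zX); exists j => //; lia.
Qed.

Definition cylinder {T : Type} (X : nat -> T -> Z2) (s : seq Z2) : set T :=
  [set w | forall i, (i < size s)%N -> increment X i w = s`_i].

Lemma cylinder_rcons {T : Type} (X : nat -> T -> Z2) s e :
  cylinder X (rcons s e) =
  cylinder X s `&` (increment X (size s) @^-1` [set e]).
Proof.
apply/seteqP; split=> [w cw|w [cw we] i].
  split=> [i si|/=].
    by have := cw i; rewrite size_rcons nth_rcons si; apply; exact: ltnW.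
  by have := cw (size s); rewrite size_rcons nth_rcons ltnn eqxx; apply.
rewrite size_rcons nth_rcons ltnS leq_eqVlt.
by case: ltngtP => //= [/cw|->].
Qed.

Lemma cylinder_position {T : Type} (X : nat -> T -> Z2) s w :
  X 0%N w = 0 -> cylinder X s w -> X (size s) w = \sum_(e <- s) e.
Proof.
move=> X0; elim/last_ind: s => [|s e IH]; first by rewrite big_nil.
rewrite cylinder_rcons => -[/IH cs /= <-].
by rewrite size_rcons -cats1 big_cat big_seq1 /= -cs /increment addrC subrK.
Qed.

Section Law.
Context {d : measure_display} {T : measurableType d} {R : realType}
  {P : probability T R} {X : nat -> T -> Z2} (hX : simple_random_walk P X).

Let mI n U : measurable (increment X n @^-1` U).
Proof. by apply: increment_discrete_rv => k; exact: walk_measurable hX k. Qed.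

Lemma measurable_cylinder s : measurable (cylinder X s).
Proof.
elim/last_ind: s => [|s e IH].
  by rewrite [cylinder _ _](_ : _ = setT); [|exact/seteqP].
by rewrite cylinder_rcons; exact: measurableI.
Qed.

Lemma probability_cylinder s : all [in unit_steps] s ->
  P (cylinder X s) = (4^-1 ^+ size s)%:E.
Proof.
move=> /allP su.
pose J := [fset i in iota 0 (size s)]%fset.
have := steps_independent hX J (fun i => [set s`_i]).
rewrite [\bigcap_(_ in _) _](_ : _ = cylinder X s); last first.
  apply/seteqP; split=> w cw i.
    by move=> si; apply: cw; rewrite /J /= !inE mem_iota.
  by rewrite /J /= !inE mem_iota; exact: cw.
move=> ->.
rewrite (perm_big (iota 0 (size s))) /=; last first.
  by apply: uniq_perm; rewrite ?fset_uniq ?iota_uniq // => i; rewrite !inE.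
rewrite big_seq (eq_bigr (fun=> (4^-1)%:E)); last first.
  move=> i; rewrite mem_iota /= => si; apply: (steps_uniform hX).
  exact: su (mem_nth _ _).
by rewrite -big_seq prodEFin big_const_seq count_predT size_iota iter_mulr_1.
Qed.

Lemma measure_split_seq k (F : set T) (r : seq Z2) : measurable F -> uniq r ->
  P F = (P (F `&` increment X k @^-1` [set e | e \notin r]) +
         \sum_(e <- r) P (F `&` increment X k @^-1` [set e]))%E.
Proof.
move=> mF; elim: r => [_|a r IH /= /andP[ar ur]].
  by rewrite big_nil adde0; congr (P _); apply/seteqP; split=> w //= [].
rewrite big_cons (IH ur) addeA; congr (_ + _)%E.
rewrite (measureDI P _ (mI k [set a])); last exact: measurableI.
congr (P _ + P _)%E; apply/seteqP; split => w /=.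
- by move=> [[Fw wr] /eqP wa]; rewrite in_cons negb_or wa.
- by rewrite in_cons negb_or => -[Fw /andP[/eqP]].
- by move=> [[Fw wr] wa].
- by move=> [Fw ->].
Qed.

(** The increments are only known to take the four unit steps as values almost
surely, since the four probabilities add up to one. *)
Lemma probability_split_step k (F : set T) : measurable F ->
  P F = (\sum_(e <- unit_steps) P (F `&` increment X k @^-1` [set e]))%E.
Proof.
move=> mF; have uu : uniq unit_steps by [].
rewrite (measure_split_seq k F _ mF uu).
have N0 : P (increment X k @^-1` [set e | e \notin unit_steps]) = 0%E.
  have := measure_split_seq k setT _ measurableT uu.
  rewrite probability_setT setTI big_seq.
  rewrite (eq_bigr (fun=> (4^-1)%:E)); last first.
    by move=> e eu; rewrite setTI; exact: steps_uniform hX _ _ eu.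
  rewrite -big_seq sumEFin big_const_seq /=.
  move: (fin_num_measure P _ (mI k [set e | e \notin unit_steps])).
  case: (P _) => // r _ [].
  by rewrite !addr0 => /esym rE; congr _%:E; lra.
rewrite (_ : P (F `&` _) = 0%E) ?add0e //.
apply/eqP; rewrite -measure_le0 -N0 le_measure ?inE //.
exact: measurableI.
Qed.

(** The Markov property at the end of a prescribed initial path [s].  Keeping
the path in the event lets the recursion of [covering_count] act on the future
without conditional probabilities. *)
Lemma probability_cylinder_covers n s (C : set Z2) : finite_set C ->
  all [in unit_steps] s ->
  P (cylinder X s `&` covers_from X (size s) n C) =
  ((4^-1 ^+ (size s + n)) * (covering_count n (\sum_(e <- s) e) C)%:R)%:E.
Proof.
elim: n s C => [|n IH] s C fC su.
  rewrite addn0 /=; case: asboolP => C0.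
    rewrite mulr1 -probability_cylinder //; congr (P _).
    by apply: setIidl => w _ z; rewrite C0.
  rewrite mulr0 (_ : _ `&` _ = set0) ?measure0 //; apply/seteqP; split=> // w.
  by move=> [_ cw]; apply: C0; apply/seteqP; split=> // z /cw[j]; lia.
set x := \sum_(e <- s) e.
have step e : (cylinder X s `&` covers_from X (size s) n.+1 C) `&`
    increment X (size s) @^-1` [set e] =
    cylinder X (rcons s e) `&`
    covers_from X (size (rcons s e)) n (C `\ x).
  rewrite cylinder_rcons size_rcons setIAC.
  apply/seteqP; split=> w [[cs ie] cw]; (split; first by []); move: cw;
    by rewrite /x -(cylinder_position X s w (walk_start hX w) cs)
      => /covers_fromS.
rewrite (probability_split_step (size s)); last first.
  apply: measurableI; first exact: measurable_cylinder.
  by apply: measurable_covers_from fC; exact: walk_measurable hX.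
under eq_bigr do rewrite step.
rewrite big_seq (eq_bigr (fun e => (4^-1 ^+ (size s + n.+1) *
    (covering_count n (x + e) (C `\ x))%:R)%:E)).
  by rewrite -big_seq sumEFin -mulr_sumr /= natr_sum.
move=> e eu; rewrite IH ?all_rcons ?eu //; last exact: finite_setD.
by rewrite size_rcons addSnnS -cats1 big_cat big_seq1.
Qed.

(** [L] steps give [L + 1] positions, hence the shift in the first argument of
[covering_count], compensated by one more factor [1 / 4]. *)
Lemma probability_trace L (C : set Z2) : finite_set C ->
  P [set w | C `<=` Trace (X^~ w) L] =
  (4^-1 ^+ L.+1 * (covering_count L.+1 0 C)%:R)%:E.
Proof.
move=> fC; have := @probability_cylinder_covers L.+1 [::] C fC isT.
rewrite big_nil => <-; congr (P _); apply/seteqP; split=> w.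
  by move=> cw; split=> // z /cw[j [jL e]]; exists j.
by move=> [_ cw] z /cw[j jL e]; exists j.
Qed.

End Law.

Theorem theorem1p1 (d : measure_display) (T : measurableType d) (R : realType)
  (P : probability T R) (X : nat -> T -> Z2) (l0 : int) (A0 B0 : set Z2)
  (L : nat)
  (hX : simple_random_walk P X)
  (hl0 : 0 <= l0)
  (hA0 : finite_set A0) (hB0 : finite_set B0)
  (hA0l : A0 `<=` half_plane l0) (hB0l : B0 `<=` half_plane l0)
  (hAB : A0 `&` B0 = set0) :
  (P [set w | A0 `|` reflection l0 @` B0 `<=` Trace (X^~ w) L] <=
   P [set w | A0 `|` B0 `<=` Trace (X^~ w) L])%E.
Proof.
rewrite !(probability_trace hX); last 2 first.
- by rewrite finite_setU.
- by rewrite finite_setU; split=> //; exact: finite_image.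
rewrite lee_fin ler_wpM2l ?exprn_ge0 ?invr_ge0 // ler_nat.
apply: (covering_count_reflection l0 L.+1).1 => //.
by rewrite /half_plane /= add0r.
Qed.
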